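(* Let Assumptions A1 and A2 (see context) hold and let $p_i\in(0,1)$ for all $i=1,\dots,m$. Then there exists $p^*\in(0,1)$ such that, with $\epsilon=\omega^{p^*-1}$, the control-affine system $$\frac{dx}{d\tau}=\frac1\omega\sum_{i=1}^m\omega^{p_i}u_i(k_i\tau)\,b_i(x)$$ can be written in the averaging canonical form $$\frac{dx}{d\tau}=\epsilon f(x,\tau;\epsilon),$$ where $f(x,\tau;\epsilon)\in\mathbb{R}^n$ is smooth in $x$, Riemann integrable and periodic in $\tau$, and with $$\lim_{\epsilon\to0}\epsilon f(x,\tau;\epsilon)=0 .$$
   Context: Here $x\in\mathbb{R}^n$, $\omega>0$ is a (large) parameter, $k_i\in\mathbb{Q}_{>0}$, and $\tau=\omega t$. Since $p^*<1$, $\epsilon\to0$ is equivalent to $\omega\to\infty$, and $0<\epsilon\ll1$ is the small parameter of the canonical form. Assumption A1: $\mathbb{D}\subset\mathbb{R}^n$ is the domain, and for every compact $\mathbb{D}_0\subset\mathbb{D}$ and each $i$, $b_i$ and all its partial derivatives of all orders are continuous and bounded on $\mathbb{D}_0$. Assumption A2: for $i=1,\dots,m$, $t\mapsto u_i(k_i\omega t)$ on $[0,\infty)$ is measurable; there are $N_i,M_i\in(0,\infty)$ with $|u_i(k_i\omega t_1)-u_i(k_i\omega t_2)|\le N_i|t_1-t_2|$ for all $t_1,t_2\ge0$ and $\sup_t|u_i(k_i\omega t)|\le M_i$; it is $T$-periodic with $\int_0^Tu_i(k_i\omega t)\,dt=0$, where $T=(2\pi/\omega)\mathrm{LCM}(k_1^{-1},\dots,k_m^{-1})$.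 In the time $\tau=\omega t$ the period is $T'=\omega T$. *)

(* Defs.v *)
From HB Require Import structures.
From mathcomp Require Import all_boot all_order all_algebra.
From mathcomp Require Import all_classical all_reals all_analysis.

Set Implicit Arguments.
Unset Strict Implicit.
Unset Printing Implicit Defensive.

Import Order.TTheory GRing.Theory Num.Theory.
Import numFieldNormedType.Exports.

Local Open Scope classical_set_scope.
Local Open Scope ring_scope.

(* Least common multiple of positive rationals: for fractions in lowest terms,
   the lcm of the numerators over the gcd of the denominators.  lcmqP below
   states that its integer multiples are exactly the common integer multiples
   of the q i. *)
Definition lcmq (m : nat) (q : 'I_m -> rat) : rat :=
  (\big[lcmn/1%N]_(i < m) `|numq (q i)|%N)%:R /
  (\big[gcdn/0%N]_(i < m) `|denq (q i)|%N)%:R.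

Lemma int_div_ratP (r q : rat) : 0 < q ->
  (r / q \is a Num.int) =
  (`|numq q| %| `|numq r|)%N && (`|denq r| %| `|denq q|)%N.
Proof.
move=> q0.
have nq0 : numq q != 0 by rewrite numq_eq0 gt_eqF.
have -> : r / q = (numq r * denq q)%:~R / (denq r * numq q)%:~R.
  by rewrite -{1}(divq_num_den r) -{1}(divq_num_den q) invf_div mulf_div -!intrM.
have /eqP cr := coprime_num_den r; have /eqP cq := coprime_num_den q.
have dr0 : denq r * numq q != 0 by rewrite mulf_neq0 // denq_neq0.
have -> : ((numq r * denq q)%:~R / (denq r * numq q)%:~R \is a @Num.int rat)
   = (denq r * numq q %| numq r * denq q)%Z.
  apply/idP/idP => [/intrP[z] /(canRL (divfK _)) E|/dvdzP[z ->]].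
    apply/dvdzP; exists z; apply: (@intr_inj rat).
    by rewrite [RHS]intrM; apply: E; rewrite intr_eq0.
  by rewrite intrM mulfK ?intr_eq0 // intr_int.
rewrite dvdzE !abszM; apply/idP/andP => [H|[H1 H2]]; last first.
  by rewrite mulnC dvdn_mul.
have c1 : coprime `|numq q| `|denq q| by apply/eqP.
have c2 : coprime `|denq r| `|numq r| by rewrite coprime_sym; apply/eqP.
split.
  by rewrite -(Gauss_dvdl _ c1); apply: dvdn_trans H; apply: dvdn_mull.
by rewrite -(Gauss_dvdr _ c2); apply: dvdn_trans H; apply: dvdn_mulr.
Qed.

Lemma lcmq_gt0 (m : nat) (q : 'I_m -> rat) :
  (0 < m)%N -> (forall i, 0 < q i) -> 0 < lcmq q.
Proof.
move=> m0 q0; apply: divr_gt0; rewrite ltr0n.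
  elim/big_ind: _ => // [x y x0 y0|i _]; first by rewrite lcmn_gt0 x0.
  by rewrite absz_gt0 numq_eq0 gt_eqF.
rewrite (bigD1 (Ordinal m0)) //= gcdn_gt0; apply/orP; left.
by rewrite absz_gt0 denq_neq0.
Qed.

Lemma lcmqP (m : nat) (q : 'I_m -> rat) (r : rat) :
  (0 < m)%N -> (forall i, 0 < q i) ->
  (r / lcmq q \is a Num.int) <-> (forall i, r / q i \is a Num.int).
Proof.
move=> m0 q0; have L0 := lcmq_gt0 m0 q0.
set N := (\big[lcmn/1%N]_(i < m) `|numq (q i)|%N).
set G := (\big[gcdn/0%N]_(i < m) `|denq (q i)|%N).
have cNG : coprime N G.
  rewrite /N; elim/big_rec: _ => [|i x _ cx]; first exact: coprime1n.
  have ci : coprime `|numq (q i)| G.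
    apply: coprime_dvdr (coprime_num_den (q i)).
    exact: biggcdn_inf (dvdnn _).
  apply: (@coprime_dvdl _ (`|numq (q i)| * x)%N).
    by rewrite dvdn_lcm dvdn_mulr // dvdn_mull.
  by rewrite coprimeMl ci.
have G0 : (0 < G)%N.
  by rewrite lt0n; apply/eqP => g; move: L0; rewrite /lcmq -/G g invr0 mulr0 ltxx.
have LE : lcmq q = (N%:Z)%:Q / (G%:Z)%:Q by [].
have numL : numq (lcmq q) = N%:Z.
  by rewrite LE coprimeq_num //= gtr0_sg ?mul1r // ltz_nat.
have denL : denq (lcmq q) = G%:Z.
  by rewrite LE coprimeq_den //= eqz_nat gtn_eqF //.
rewrite int_div_ratP // numL denL /=; split.
  move=> /andP[/dvdn_biglcmP HN /dvdn_biggcdP HG] i.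
  by rewrite int_div_ratP // HN // HG.
move=> H; apply/andP; split.
  by apply/dvdn_biglcmP => i _; have := H i; rewrite int_div_ratP // => /andP[].
by apply/dvdn_biggcdP => i _; have := H i; rewrite int_div_ratP // => /andP[].
Qed.

Section Analysis.
Variable R : realType.

(* Riemann sums over tagged partitions a = x_0 < ... < x_N = b, where
   s = [:: x_1; ...; x_N] and t j is the tag of the j-th subinterval. *)
Definition riemann_sum (V : normedModType R) (g : R -> V) (a : R)
    (s : seq R) (t : nat -> R) : V :=
  \sum_(j < size s) (nth a (a :: s) j.+1 - nth a (a :: s) j) *: g (t j).

Definition riemann_integrable (V : normedModType R) (a b : R) (g : R -> V) :=
  exists I : V, forall e : R, 0 < e -> exists2 d : R, 0 < d &
    forall (s : seq R) (t : nat -> R),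
      itv_partition a b s ->
      (forall j, (j < size s)%N ->
         nth a (a :: s) j.+1 - nth a (a :: s) j < d /\
         nth a (a :: s) j <= t j <= nth a (a :: s) j.+1) ->
      `|riemann_sum g a s t - I| < e.

Variable n : nat.

Fixpoint iter_partial (s : seq 'I_n) (g : 'rV[R]_n -> 'rV[R]_n) :
    'rV[R]_n -> 'rV[R]_n :=
  if s is j :: s' then fun x => 'D_(delta_mx 0 j) (iter_partial s' g) x else g.

(* 'D_v is a total operator: existence has to be required separately. *)
Definition all_partials_exist (D : set 'rV[R]_n) (g : 'rV[R]_n -> 'rV[R]_n) :=
  forall (s : seq 'I_n) (j : 'I_n) (x : 'rV[R]_n), D x ->
    derivable (iter_partial s g) x (delta_mx 0 j).

Definition smooth_on (D : set 'rV[R]_n) (g : 'rV[R]_n -> 'rV[R]_n) :=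
  all_partials_exist D g /\
  forall s : seq 'I_n, {within D, continuous (iter_partial s g)}.

Variable m : nat.

Definition assumption_A1 (D : set 'rV[R]_n)
    (b : 'I_m -> 'rV[R]_n -> 'rV[R]_n) :=
  open D /\
  forall i, all_partials_exist D (b i) /\
    forall D0 : set 'rV[R]_n, compact D0 -> D0 `<=` D ->
      forall s : seq 'I_n,
        {within D0, continuous (iter_partial s (b i))} /\
        [bounded iter_partial s (b i) x | x in D0].

Definition period (k : 'I_m -> rat) (omega : R) : R :=
  2 * pi / omega * ratr (lcmq (fun i => (k i)^-1)).

(* Only the values of u i on [0, +oo[ are constrained.  The constants N and M
   may depend on omega: rescaling time rescales the Lipschitz constant. *)
Definition assumption_A2 (k : 'I_m -> rat) (u : 'I_m -> R -> R) (omega : R) :=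
  let T := period k omega in
  forall i, let v := fun t : R => u i (ratr (k i) * omega * t) in
  [/\ measurable_fun (`[0, +oo[%classic : set R) v,
      exists2 N : R, 0 < N &
        forall t1 t2 : R, 0 <= t1 -> 0 <= t2 -> `|v t1 - v t2| <= N * `|t1 - t2|,
      exists2 M : R, 0 < M & forall t : R, 0 <= t -> `|v t| <= M,
      forall t : R, 0 <= t -> v (t + T) = v t &
      (\int[lebesgue_measure]_(t in `[0%R, T]) (v t)%:E = 0)%E].

(* Right-hand side of the control-affine system in the time tau. *)
Definition control_affine_field (k : 'I_m -> rat) (p : 'I_m -> R)
    (u : 'I_m -> R -> R) (b : 'I_m -> 'rV[R]_n -> 'rV[R]_n)
    (omega : R) (x : 'rV[R]_n) (tau : R) : 'rV[R]_n :=
  omega^-1 *: \sum_(i < m) (omega `^ p i * u i (ratr (k i) * tau)) *: b i x.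

End Analysis.

(* Main.v *)
(* Every pstar in ]0, 1[ works.  For pstar = 1/2 the relation
   omega = eps ^ (-2) gives omega ^ (p i - 1) = eps * eps ^ (1 - 2 * p i), so f
   is the combination of the b i with coefficients eps ^ (1 - 2 * p i) * u i,
   and eps * f tends to 0 because 2 - 2 * p i > 0.  The u i do not depend on
   omega and T' = period k 1, so A2 is applied at omega = 1.  The u i
   being Lipschitz, they have primitives on segments, and the mean value theorem
   compares Riemann sums with the increment of a primitive. *)
Require Import Defs.
From HB Require Import structures.
From mathcomp Require Import all_boot all_order all_algebra.
From mathcomp Require Import all_classical all_reals all_analysis.
From mathcomp Require Import ring lra.

Set Implicit Arguments.
Unset Strict Implicit.

Import Order.TTheory GRing.Theory Num.Theory.
Import numFieldNormedType.Exports.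

Local Open Scope classical_set_scope.
Local Open Scope ring_scope.

(** * Smoothness of linear combinations of vector fields *)

Lemma iter_partial_lincomb (R : realType) (n m : nat) (D : set 'rV[R]_n)
    (g : 'I_m -> 'rV[R]_n -> 'rV[R]_n) (c : 'I_m -> R) (s : seq 'I_n) :
  open D -> (forall i, all_partials_exist D (g i)) ->
  forall x, D x -> iter_partial s (\sum_(i < m) c i \*: g i) x =
                   (\sum_(i < m) c i \*: iter_partial s (g i)) x.
Proof.
move=> oD dg; elim: s => [//|j s IH] x Dx /=.
have dgi i : derivable (c i \*: iter_partial s (g i)) x (delta_mx 0 j).
  by apply: derivableZ; exact: dg.
(* The induction hypothesis is an equality on [D] only; since [D] is open it holds near [x], so both
   sides have the same directional derivative there. *)
rewrite (near_eq_derive (g := \sum_(i < m) c i \*: iter_partial s (g i))); last first.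
  by near=> y; apply: IH; near: y; exact: open_nbhs_nbhs.
rewrite derive_sum // fct_sumE; apply: eq_bigr => i _.
by rewrite deriveZ //; exact: dg.
Unshelve. all: by end_near. Qed.

Lemma smooth_on_lincomb (R : realType) (n m : nat) (D : set 'rV[R]_n)
    (g : 'I_m -> 'rV[R]_n -> 'rV[R]_n) (c : 'I_m -> R) :
  open D -> (forall i, smooth_on D (g i)) ->
  smooth_on D (\sum_(i < m) c i \*: g i).
Proof.
move=> oD sg; have dg i := (sg i).1; have E := iter_partial_lincomb c _ oD dg.
split=> [s j x Dx|s].
  apply: (near_eq_derivable (f := \sum_(i < m) c i \*: iter_partial s (g i))).
    by near=> y; apply/esym/E; near: y; exact: open_nbhs_nbhs.
  by apply: derivable_sum => i; apply: derivableZ; exact: dg.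
apply: (subspace_eq_continuous (f := \sum_(i < m) c i \*: iter_partial s (g i))).
  by move=> x /set_mem Dx; rewrite -E.
move=> x; rewrite /continuous_at fct_sumE; apply: (cvg_big add_continuous) => i _.
by apply: cvgZr; exact: (sg i).2.
Unshelve. all: by end_near. Qed.

(** A1 controls the partial derivatives only on compact subsets. Each point of the open set [D] is
    the centre of a closed ball inside [D], compact in finite dimension, and continuity on it
    restricts to the open ball, a neighbourhood of the point. *)
Lemma assumption_A1_smooth (R : realType) (n m : nat) (D : set 'rV[R]_n)
    (b : 'I_m -> 'rV[R]_n -> 'rV[R]_n) (i : 'I_m) :
  assumption_A1 D b -> smooth_on D (b i).
Proof.
move=> [oD /(_ i)[dbi cbi]]; split=> // s.
rewrite continuous_open_subspace// => x /set_mem Dx.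
have [e eD] : exists e : {posnum R}, closed_ball x e%:num `<=` D.
  by apply/nbhs_closedballP; exact: open_nbhs_nbhs.
have cK : compact (closed_ball x e%:num).
  apply: bounded_closed_compact; last exact: closed_ball_closed.
  exists (`|x| + e%:num); split; first exact: num_real.
  move=> M ltM y; rewrite closed_ballE// /closed_ball_ /= => xy.
  have := ler_normB x (x - y); rewrite subKr; lra.
have [+ _] := cbi _ cK eD s.
move=> /(continuous_subspaceW (@subset_closure _ (ball x e%:num))).
rewrite continuous_open_subspace; last exact: ball_open.
by apply; apply/mem_set; exact: ballxx.
Qed.

(** * Riemann integrability of Lipschitz functions and of their vector combinations *)

Section RiemannIntegrable.
Context {R : realType}.

Lemma lipschitz_within_continuous (A : set R) (g : R -> R) (N : R) : 0 < N ->
  (forall x y, A x -> A y -> `|g x - g y| <= N * `|x - y|) ->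
  {within A, continuous g}.
Proof.
move=> N0 lip; apply/subspace_continuousP => x Ax.
apply/cvgrPdist_lt => e e0; rewrite near_withinE; near=> y => Ay.
apply: le_lt_trans (lip _ _ Ax Ay) _.
rewrite -ltr_pdivlMl//; near: y.
by apply: nbhsx_ballx; rewrite ?mulr_gt0 ?invr_gt0.
Unshelve. all: by end_near. Qed.

(** [G] is the integral of [g] from [a]. The mean value theorem gives [G y - G x = g c * (y - x)],
    and the tag [t] is within [y - x] of [c]. The error is quadratic in the length of the
    subinterval, hence small after summation over a fine partition. *)
Lemma lipschitz_primitive (a b : R) (g : R -> R) (N : R) : a <= b -> 0 < N ->
  (forall x y, a <= x <= b -> a <= y <= b -> `|g x - g y| <= N * `|x - y|) ->
  exists G : R -> R, forall x t y, a <= x -> x <= t <= y -> y <= b ->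
    `|(y - x) * g t - (G y - G x)| <= N * (y - x) * (y - x).
Proof.
move=> ab N0 lip.
have cg : {within `[a, b], continuous g}.
  by apply: (lipschitz_within_continuous N0) => x y /=; rewrite !in_itv; exact: lip.
have ig : lebesgue_measure.-integrable `[a, b] (EFin \o g).
  by apply: continuous_compact_integrable => //; exact: segment_compact.
pose G x := parameterized_integral lebesgue_measure a x g; exists G.
move=> x t y ax /andP[xt ty] yb; have xy := le_trans xt ty.
have [||c] := MVT_segment (f := G) (df := g) xy.
- move=> z; rewrite in_itv/= => /andP[xz zy].
  have az := le_lt_trans ax xz; have zb := lt_le_trans zy yb.
  have abz : z \in `]a, b[ by rewrite in_itv/= az.
  have cz : {for z, continuous g}.
    have aLb := lt_trans az zb.
    by have /(continuous_within_itvP _ aLb)[+ _ _] := cg; apply.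
  have [dG GE] := continuous_FTC1_closed zb ig az cz.
  by rewrite -GE derive1E; apply: derivableP.
- apply: continuous_subspaceW (parameterized_integral_continuous ab ig).
  by move=> z /=; rewrite !in_itv/= => /andP[xz zy];
    rewrite (le_trans ax xz) (le_trans zy yb).
rewrite in_itv/= => /andP[xc cy] ->.
rewrite [g c * _]mulrC -mulrBr normrM ger0_norm ?subr_ge0// mulrC.
apply: ler_wpM2r; first by rewrite subr_ge0.
apply: le_trans (lip _ _ _ _) _; first by apply/andP; split; lra.
  by apply/andP; split; lra.
by rewrite ler_pM2l// ler_norml; apply/andP; split; lra.
Qed.

Lemma lipschitz_riemann_integrable (a b : R) (g : R -> R^o) (N : R) :
  a <= b -> 0 < N ->
  (forall x y, a <= x <= b -> a <= y <= b -> `|g x - g y| <= N * `|x - y|) ->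
  riemann_integrable a b g.
Proof.
move=> ab N0 lip; have [G HG] := lipschitz_primitive ab N0 lip.
exists (G b - G a) => e e0.
(* The [+ 1] keeps the denominator of [d] positive when [a = b] and makes the final bound
   [N * d * (b - a) < e] strict. *)
have C0 : 0 < N * (b - a) + 1 by rewrite ltr_wpDl// mulr_ge0 ?subr_ge0// ltW.
pose d := e / (N * (b - a) + 1); exists d; first exact: divr_gt0.
move=> s t abs Hst; set X := nth a (a :: s) in Hst *.
have XE : X (size s) = b by exact: itv_partition_nth_size abs.
have Xab j : (j < (size s).+1)%N -> a <= X j <= b.
  (* The index is in range, so the default value of [nth] can be changed freely. *)
  move=> js; rewrite /X (set_nth_default b)//.
  by rewrite (itv_partition_nth_ge js abs) (itv_partition_nth_le js abs).
(* Used with [G] to split the integral into increments, and with [id] to sum the lengths of the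
   subintervals to [b - a]. *)
have tel (F : R -> R) :
    F b - F a = \sum_(j < size s) (F (X j.+1) - F (X j)).
  by rewrite -XE -(telescope_sumr (F \o X) (leq0n _)) big_mkord.
rewrite /riemann_sum (tel G) -sumrB.
apply: (@le_lt_trans _ _ (N * d * (b - a))).
  rewrite (tel id) mulr_sumr; apply: le_trans (ler_norm_sum _ _ _) _.
  apply: ler_sum => j _; have [Xd Xt] := Hst _ (ltn_ord j).
  have /andP[aX _] := Xab j (ltnW (ltn_ord j)).
  have /andP[_ Xb] := Xab j.+1 (ltn_ord j).
  apply: le_trans (HG _ _ _ aX Xt Xb) _; have /andP[Xt1 Xt2] := Xt.
  apply: ler_wpM2r; first by rewrite subr_ge0 (le_trans Xt1).
  by rewrite ler_pM2l// ltW.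
rewrite mulrAC /d mulrA ltr_pdivrMr// mulrC ltr_pM2l//; lra.
Qed.

Context {V : normedModType R}.
Implicit Types (a b : R) (g h : R -> V).

(** For fixed [x], each summand of the field is a scalar function of time multiplied by the constant
    vector [b i x]; this reduces its integrability to the scalar case. *)
Lemma riemann_integrableZr a b (g : R -> R^o) (v : V) :
  riemann_integrable a b g -> riemann_integrable a b (fun t => g t *: v).
Proof.
move=> [I HI]; exists (I *: v) => e e0.
(* Dividing by [|v| + 1] instead of [|v|] covers [v = 0]. *)
have v0 : 0 < `|v| + 1 by rewrite ltr_wpDl.
have [d d0 Hd] := HI (e / (`|v| + 1)) (divr_gt0 e0 v0).
exists d => // s t abs Hst; have := Hd s t abs Hst.
have -> : riemann_sum (fun t => g t *: v) a s t = riemann_sum g a s t *: v.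
  by rewrite /riemann_sum scaler_suml; apply: eq_bigr => j _; rewrite scalerA.
rewrite -scalerBl normrZ => lt.
apply: (@le_lt_trans _ _ (`|riemann_sum g a s t - I| * (`|v| + 1))).
  by rewrite ler_wpM2l// lerDl.
by rewrite -ltr_pdivlMr.
Qed.

Lemma riemann_integrable0 a b : riemann_integrable a b (fun=> 0 : V).
Proof.
exists 0 => e e0; exists 1 => // s t _ _; rewrite /riemann_sum big1 => [|j _].
  by rewrite subr0 normr0.
by rewrite scaler0.
Qed.

Lemma riemann_integrableD a b g h : riemann_integrable a b g ->
  riemann_integrable a b h -> riemann_integrable a b (fun t => g t + h t).
Proof.
move=> [I HI] [J HJ]; exists (I + J) => e e0.
have e2 : 0 < e / 2 by rewrite divr_gt0.
have [d1 d10 H1] := HI _ e2; have [d2 d20 H2] := HJ _ e2.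
exists (Num.min d1 d2) => [|s t abs Hst]; first by rewrite lt_min d10.
have {}H1 : `|riemann_sum g a s t - I| < e / 2.
  by apply: H1 => // j /Hst[]; rewrite lt_min => /andP[].
have {}H2 : `|riemann_sum h a s t - J| < e / 2.
  by apply: H2 => // j /Hst[]; rewrite lt_min => /andP[].
have -> : riemann_sum (fun t => g t + h t) a s t =
    riemann_sum g a s t + riemann_sum h a s t.
  by rewrite /riemann_sum -big_split; apply: eq_bigr => j _; rewrite scalerDr.
rewrite opprD addrACA (splitr e).
by apply: le_lt_trans (ler_normD _ _) _; exact: ltrD.
Qed.

Lemma riemann_integrable_sum (I : Type) (r : seq I) (F : I -> R -> V) a b :
  (forall i, riemann_integrable a b (F i)) ->
  riemann_integrable a b (fun t => \sum_(i <- r) F i t).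
Proof.
move=> HF; elim: r => [|i r IH].
  by under eq_fun do rewrite big_nil; exact: riemann_integrable0.
by under eq_fun do rewrite big_cons; exact: riemann_integrableD.
Qed.

End RiemannIntegrable.

(** * The averaging canonical form *)

Unset Implicit Arguments.
Set Strict Implicit.

Theorem lemma1 (R : realType) (n m : nat) (m_gt0 : (0 < m)%N)
    (D : set 'rV[R]_n) (b : 'I_m -> 'rV[R]_n -> 'rV[R]_n)
    (k : 'I_m -> rat) (u : 'I_m -> R -> R) (p : 'I_m -> R)
    (k_gt0 : forall i, 0 < k i)
    (A1 : assumption_A1 D b)
    (A2 : forall omega : R, 0 < omega -> assumption_A2 k u omega)
    (p01 : forall i, 0 < p i < 1) :
  exists pstar : R, 0 < pstar < 1 /\
  exists f : 'rV[R]_n -> R -> R -> 'rV[R]_n,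
    (forall omega : R, 0 < omega ->
       let eps := omega `^ (pstar - 1) in
       let T' := omega * period k omega in
       [/\ forall x (tau : R), D x -> 0 <= tau ->
             control_affine_field k p u b omega x tau = eps *: f x tau eps,
           forall tau : R, 0 <= tau -> smooth_on D (fun x => f x tau eps),
           forall x, D x -> forall t1 t2 : R, 0 <= t1 -> t1 <= t2 ->
             riemann_integrable t1 t2 (fun tau => f x tau eps) &
           forall x (tau : R), D x -> 0 <= tau -> f x (tau + T') eps = f x tau eps])
    /\
    (forall x (tau : R), D x -> 0 <= tau ->
       (fun eps : R => eps *: f x tau eps) @ 0^'+ --> (0 : 'rV[R]_n)).
Proof.
exists 2^-1; split; first by apply/andP; split; lra.
exists (fun x tau eps =>
  \sum_(i < m) (eps `^ (1 - 2 * p i) * u i (ratr (k i) * tau)) *: b i x).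
split=> [omega o0 eps T'|x tau Dx tau0].
  have e0 : 0 < eps by exact: powR_gt0.
  split=> [x tau _ _|tau _|x _ t1 t2 t10 t12|x tau _ tau0].
  - rewrite /control_affine_field !scaler_sumr; apply: eq_bigr => i _.
    rewrite !scalerA !mulrA; congr (_ * _ *: _).
    (* Each side is merged into one power, [omega] to [-1 + p i] and [eps] to [1 + (1 - 2 * p i)];
       as [eps] is [omega] to the power [-1/2], the exponents agree. *)
    rewrite -[X in X * _ = _]powR_inv1 ?ltW// -[X in _ = X * _]powRr1 ?ltW//.
    rewrite -!powRD ?(gt_eqF o0) ?(gt_eqF e0) ?implybT// /eps.
    by rewrite -powRrM; congr (_ `^ _); lra.
  (* At a fixed time the coefficients do not depend on [x]. *)
  - pose c i := eps `^ (1 - 2 * p i) * u i (ratr (k i) * tau).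
    have -> : (fun x => \sum_(i < m) c i *: b i x) = \sum_(i < m) c i \*: b i.
      by apply/funext => x; rewrite fct_sumE.
    by apply: smooth_on_lincomb A1.1 _ => i; exact: assumption_A1_smooth.
  - apply: riemann_integrable_sum => i; apply: riemann_integrableZr.
    have [_ [N N0 lip] _ _ _] := A2 1 ltr01 i.
    have C0 : 0 < eps `^ (1 - 2 * p i) by exact: powR_gt0.
    apply: (lipschitz_riemann_integrable t12 (mulr_gt0 C0 N0)) => y z.
    (* The Lipschitz bound holds for nonnegative times only; [0 <= t1] places [y] and [z] among
       them. *)
    move=> /andP[y1 _] /andP[z1 _].
    rewrite -mulrBr normrM gtr0_norm// -[leRHS]mulrA ler_pM2l//.
    by have := lip y z (le_trans t10 y1) (le_trans t10 z1); rewrite !mulr1.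
  - apply: eq_bigr => i _; congr (_ * _ *: _).
    have [_ _ _ per _] := A2 1 ltr01 i.
    have <- : period k (1 : R) = T'.
      by rewrite /T' /period invr1 mulr1; field; rewrite gt_eqF.
    by have := per tau tau0; rewrite !mulr1.
pose v i := u i (ratr (k i) * tau) *: b i x.
have : (\sum_(i < m) eps `^ (2 - 2 * p i) *: v i) @[eps --> 0^'+] -->
    \sum_(i < m) 0 *: v i.
  apply: (cvg_big add_continuous) => i _; apply: cvgZl; apply: powR_cvg0.
  by have /andP[_] := p01 i; lra.
rewrite big1 => [|i _]; last exact: scale0r.
(* The powers of [eps] merge for [eps > 0], and the right-hand filter at 0 sees no other values. *)
apply: cvg_trans; apply: near_eq_cvg; near=> eps; have e0 : 0 < eps by [].
rewrite scaler_sumr; apply: eq_bigr => i _.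
rewrite !scalerA mulrA; congr (_ * _ *: _).
rewrite -[X in _ = X * _]powRr1 ?ltW// -powRD ?(gt_eqF e0) ?implybT//.
by congr (_ `^ _); lra.
Unshelve. all: by end_near. Qed.
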